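(* The number $R(7)$ of equivalence classes of monotone Boolean functions $f:\{0,1\}^7\to\{0,1\}$ under renaming (permutation) of the variables is $R(7)=490013148$.
   Context: A monotone Boolean function on $n$ variables is a function $f:\{0,1\}^n\to\{0,1\}$ such that $x\le y$ (i.e. $x_i\le y_i$ for all $i$) implies $f(x)\le f(y)$. The constant functions $0$ and $1$ are included. Two monotone Boolean functions $f,g$ on $n$ variables are equivalent, $f\sim g$, if $g$ can be obtained from $f$ by a renaming of the variables, i.e. there is a permutation $\sigma$ of $\{1,\dots,n\}$ with $g(x_1,\dots,x_n)=f(x_{\sigma(1)},\dots,x_{\sigma(n)})$ for all $x\in\{0,1\}^n$. $R(n)$ denotes the number of equivalence classes of $\sim$ on the set of all monotone Boolean functions on $n$ variables. *)

(* Defs.v *)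
From mathcomp Require Import all_boot fingroup perm.

Set Implicit Arguments.
Unset Strict Implicit.
Unset Printing Implicit Defensive.

Definition boolfun (n : nat) := {ffun {ffun 'I_n -> bool} -> bool}.

Definition monotone (n : nat) (f : boolfun n) : bool :=
  [forall x : {ffun 'I_n -> bool}, forall y : {ffun 'I_n -> bool},
     [forall i, x i ==> y i] ==> (f x ==> f y)].

Definition renaming_equiv (n : nat) (f g : boolfun n) : bool :=
  [exists s : 'S_n, forall x : {ffun 'I_n -> bool},
     g x == f [ffun i => x (s i)]].

Lemma renaming_equivP (n : nat) : equivalence_rel (@renaming_equiv n).
Proof.
apply/equivalence_relP; split=> [f|].
  apply/existsP; exists 1%g; apply/forallP=> x; apply/eqP; congr (f _).
  by apply/ffunP=> i; rewrite ffunE perm1.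
move=> f g /existsP[s /forallP fg] h; apply/existsP/existsP=> -[t /forallP ht].
  exists (s^-1 * t)%g; apply/forallP=> x; rewrite (eqP (ht x)).
  rewrite (eqP (fg _)); apply/eqP; congr (f _); apply/ffunP=> i.
  by rewrite !ffunE permM permK.
exists (s * t)%g; apply/forallP=> x; rewrite (eqP (ht x)) (eqP (fg _)).
apply/eqP; congr (f _); apply/ffunP=> i.
by rewrite !ffunE permM.
Qed.

Definition R (n : nat) : nat :=
  #|equivalence_partition (@renaming_equiv n) [set f | monotone f]|.

(* Main.v *)
(** By Burnside's lemma, 7! R(7) is the sum over the permutations s of the
number of monotone functions fixed by s, and this number depends only on the
cycle type of s. A monotone function fixed by s is an up-set of the poset of
orbits of s on the cube.

Fixed points of s shorten the enumeration. If s fixes one variable and acts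
as t on the others, splitting on that variable identifies the fixed functions
with the pairs g <= f in the lattice L of monotone functions fixed by t; if it
fixes two variables, with the quadruples f <= h, h' <= g in L, so their number
is the sum of |[f, g]|^2 over the intervals of L. For each f a decision tree
tabulates |[f, g]| for all g >= f at once. For the identity permutation the sum
over g depends only on f up to renaming, so it is evaluated only
at representatives of the functions of 5 variables. *)
Require Import Defs.
From Stdlib Require Import BinNat.
From mathcomp Require Import all_boot fingroup perm action.

Set Implicit Arguments.
Unset Strict Implicit.
Unset Printing Implicit Defensive.

(** * Functions fixed by a renaming, and Burnside's lemma *)

Definition rename n (phi : 'I_n -> 'I_n) (x : {ffun 'I_n -> bool}) :
  {ffun 'I_n -> bool} := [ffun i => x (phi i)].

(** An arbitrary map [phi] is allowed, so that maps read from lists or extended by a fixed variable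
    can be used directly. *)
Definition fixed n (phi : 'I_n -> 'I_n) : {set boolfun n} :=
  [set f : boolfun n | monotone f & [forall x, f (rename phi x) == f x]].

Lemma monotoneP n (f : boolfun n) :
  reflect (forall x y : {ffun 'I_n -> bool},
             (forall i, x i -> y i) -> f x -> f y) (monotone f).
Proof.
apply: (iffP forallP) => [mf x y xy | mf x].
  have /implyP le_fxy := forallP (mf x) y; apply/implyP/le_fxy.
  by apply/forallP=> i; apply/implyP/xy.
apply/forallP=> y; apply/implyP=> /forallP xy; apply/implyP.
by apply: mf => i; apply/implyP.
Qed.

Lemma fixedP n (phi : 'I_n -> 'I_n) (f : boolfun n) :
  reflect (monotone f /\ forall x, f (rename phi x) = f x) (f \in fixed phi).
Proof.
rewrite inE; apply: (iffP andP) => -[mf ff]; split=> //.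
  by move=> x; apply/eqP/(forallP ff).
by apply/forallP=> x; apply/eqP/ff.
Qed.

Section Burnside.
Variable n : nat.

Definition rename_fun (f : boolfun n) (s : 'S_n) : boolfun n :=
  [ffun x => f (rename s x)].

Lemma rename_fun1 f : rename_fun f 1%g = f.
Proof.
by apply/ffunP=> x; rewrite ffunE; congr (f _); apply/ffunP=> i; rewrite ffunE perm1.
Qed.

Lemma rename_funM f s t : rename_fun f (s * t)%g = rename_fun (rename_fun f s) t.
Proof.
apply/ffunP=> x; rewrite !ffunE; congr (f _).
by apply/ffunP=> i; rewrite !ffunE permM.
Qed.

Lemma rename_is_action : is_action [set: 'S_n] rename_fun.
Proof. exact: is_total_action rename_fun1 rename_funM. Qed.

Definition rename_action := Action rename_is_action.

Lemma monotone_rename f s : monotone (rename_fun f s) = monotone f.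
Proof.
have imp g t : monotone g -> monotone (rename_fun g t).
  move=> /monotoneP mg; apply/monotoneP=> x y xy; rewrite !ffunE.
  by apply: mg => i; rewrite !ffunE; apply: xy.
apply/idP/idP => [|/imp //] /(imp _ s^-1)%g.
by rewrite -rename_funM mulgV rename_fun1.
Qed.

(** The Cauchy-Frobenius orbit count: the classes of [renaming_equiv] on the monotone functions are
    the orbits of [rename_action]. *)
Lemma burnside : R n * n`! = \sum_(s : 'S_n) #|fixed s|.
Proof.
have actsM : [acts [set: 'S_n], on [set f : boolfun n | monotone f] | rename_action].
  apply/actsP=> s _ f; rewrite !inE; exact: monotone_rename.
have /esym := Frobenius_Cauchy actsM.
rewrite [#|[set: 'S_n]|]cardsT card_Sn.
have -> : #|orbit rename_action [set: 'S_n] @: [set f : boolfun n | monotone f]| = R n.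
  congr #|pred_of_set _|; apply/eq_in_imset=> f; rewrite inE => mf.
  apply/setP=> g; rewrite inE; apply/imsetP/andP=> [[s _ ->]|].
    split; first by rewrite inE monotone_rename.
    by apply/existsP; exists s; apply/forallP=> x; rewrite ffunE.
  case=> _ /existsP[s /forallP fg]; exists s => //.
  by apply/ffunP=> x; rewrite ffunE; apply/eqP/fg.
move=> ->; apply: eq_big => [s|s _]; first by rewrite inE.
apply: eq_card => f; rewrite in_setI !(in_set (fun _ : boolfun n => _)).
congr (_ && _); rewrite sub1set inE.
apply/eqP/forallP => [fs x|fs].
  by rewrite -[in X in _ == X]fs ffunE.
by apply/ffunP=> x; rewrite ffunE; apply/eqP/fs.
Qed.

(** Renaming by [w] maps [fixed t] bijectively onto [fixed s]. *)
Lemma card_fixed_conj (s t w : 'S_n) :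
  (forall i, s (w i) = w (t i)) -> #|fixed s| = #|fixed t|.
Proof.
move=> sw.
have swx x : rename w (rename s x) = rename t (rename w x).
  by apply/ffunP=> i; rewrite !ffunE sw.
have renK (x : {ffun 'I_n -> bool}) : rename w (rename w^-1%g x) = x.
  by apply/ffunP=> i; rewrite !ffunE permK.
have inj : injective (rename_fun^~ w).
  by move=> f g /(congr1 (rename_fun^~ w^-1%g)); rewrite -!rename_funM mulgV !rename_fun1.
rewrite -(card_imset (mem (fixed t)) inj).
apply: eq_card=> f; apply/fixedP/imsetP => [[mf ff]|[g /fixedP[mg gf] ->]].
  exists (rename_fun f w^-1%g); last first.
    by rewrite -rename_funM mulVg rename_fun1.
  apply/fixedP; rewrite monotone_rename; split=> // x.
  rewrite !ffunE -{1}[x]renK.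
  have -> : rename w^-1%g (rename t (rename w (rename w^-1%g x))) = rename s (rename w^-1%g x).
    by rewrite -swx; apply/ffunP=> i; rewrite !ffunE permKV.
  exact: ff.
split; first by rewrite monotone_rename.
by move=> x; rewrite !ffunE swx gf.
Qed.
End Burnside.

(** * Up-sets as masks, and interval counts by decision trees *)

Definition lem (u v : bitseq) : bool := all2 implb u v.

Fixpoint orm (u v : bitseq) : bitseq :=
  match u, v with a :: u', b :: v' => (a || b) :: orm u' v' | _, _ => [::] end.

(* A poset is given by a linear extension of its points: the i-th entry of [us]
   marks, among the points after the i-th, those above it. A mask selects a set
   of points, and a closed mask an up-set. *)
Fixpoint closed_mask (us : seq bitseq) (m : bitseq) : bool :=
  match us, m with
  | u :: us', b :: m' => (b ==> lem u m') && closed_mask us' m'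
  | [::], [::] => true
  | _, _ => false
  end.

(** Transitivity of the order: the points above a point form an up-set among the later ones. *)
Fixpoint transitive_rows (us : seq bitseq) : bool :=
  if us is u :: us' then closed_mask us' u && transitive_rows us' else true.

(** Branches over the closed masks above a closed [m]: a point already in the mask stays, and taking
    a free point also forces its row [u]. *)
Fixpoint masks (us : seq bitseq) (m : bitseq) : seq bitseq :=
  match us, m with
  | u :: us', b :: m' =>
    if b then map (cons true) (masks us' m')
    else map (cons false) (masks us' m') ++ map (cons true) (masks us' (orm u m'))
  | _, _ => [:: [::]]
  end.

(* A decision tree over the closed masks above a given one, branching on the
   successive points: [Up] stands for a point that is forced into the mask. *)
Inductive tree := Leaf of N | Up of tree | Fork of tree & tree.

(* [t1] ranges over the masks above a larger mask than [t0] does, so that it may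
   have [Up] where [t0] has [Fork]; the entries of [t0] absent from [t1] are
   dropped. The last case does not arise then. *)
Fixpoint add_tree (t1 t0 : tree) : tree :=
  match t1, t0 with
  | Leaf a, Leaf b => Leaf (a + b)%num
  | Up t1', Up t0' => Up (add_tree t1' t0')
  | Up t1', Fork _ t0' => Up (add_tree t1' t0')
  | Fork a1 b1, Fork a0 b0 => Fork (add_tree a1 a0) (add_tree b1 b0)
  | _, _ => t1
  end.

(* At the leaf of a mask M, the number of closed masks between [m] and M: if M
   contains the first point, these masks may contain it or not, hence the sum. *)
Fixpoint interval_tree (us : seq bitseq) (m : bitseq) : tree :=
  match us, m with
  | u :: us', b :: m' =>
    if b then Up (interval_tree us' m')
    else let t0 := interval_tree us' m' in
         Fork t0 (add_tree (interval_tree us' (orm u m')) t0)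
  | _, _ => Leaf 1
  end.

Fixpoint sum_tree (h : N -> N) (t : tree) : N :=
  match t with
  | Leaf a => h a
  | Up t' => sum_tree h t'
  | Fork t0 t1 => (sum_tree h t0 + sum_tree h t1)%num
  end.

(** The specification of a tree: the leaf at a mask [m'] carries [h m']. The results of [add_tree]
    and [interval_tree] are shown to be such tables. *)
Fixpoint tabulate (us : seq bitseq) (m : bitseq) (h : bitseq -> nat) : tree :=
  match us, m with
  | u :: us', b :: m' =>
    if b then Up (tabulate us' m' (h \o cons true))
    else Fork (tabulate us' m' (h \o cons false))
              (tabulate us' (orm u m') (h \o cons true))
  | _, _ => Leaf (bin_of_nat (h [::]))
  end.

Lemma nat_of_addN (a b : N) : (a + b)%num = a + b :> nat.
Proof. by case: a b => [|p] [|q] //=; rewrite ?addn0 // nat_of_add_pos. Qed.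

Lemma nat_of_mulN (a b : N) : (a * b)%num = a * b :> nat.
Proof. by case: a b => [|p] [|q] //=; rewrite ?muln0 // nat_of_mul_pos. Qed.

Lemma bin_of_natD a b : bin_of_nat (a + b) = (bin_of_nat a + bin_of_nat b)%num.
Proof. by apply: (can_inj nat_of_binK); rewrite nat_of_addN !bin_of_natK. Qed.

Lemma lem_refl u : lem u u.
Proof. by elim: u => [|[] u]. Qed.

Lemma lem_trans v u w : lem u v -> lem v w -> lem u w.
Proof.
elim: u v w => [|a u IH] [|b v] [|c w] //= /andP[ab uv] /andP[bc vw].
by apply/andP; split; [case: a b c ab bc => [] [] [] | apply: IH uv vw].
Qed.

Lemma lem_orm u v w : size u = size v -> lem (orm u v) w = lem u w && lem v w.
Proof.
elim: u v w => [|a u IH] [|b v] [|c w] //= [/IH e].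
by rewrite e; case: a b c => [] [] [] //=; rewrite ?andbF.
Qed.

Lemma lem_ormr u v w : lem u v -> size u = size w -> lem u (orm w v).
Proof.
elim: u v w => [|a u IH] [|b v] [|c w] //= /andP[ab uv] [uw].
by rewrite IH // andbT; case: a b c ab => [] [] [].
Qed.

Lemma lem_size u v : lem u v -> size u = size v.
Proof. by rewrite /lem all2E => /andP[/eqP]. Qed.

Lemma closed_size us m : closed_mask us m -> size m = size us.
Proof. by elim: us m => [|u us IH] [|b m] //= /andP[_ /IH->]. Qed.

Lemma ormC u v : orm u v = orm v u.
Proof. by elim: u v => [|a u IH] [|b v] //=; rewrite orbC IH. Qed.

Lemma closed_orm us u v : closed_mask us u -> closed_mask us v -> closed_mask us (orm u v).
Proof.
elim: us u v => [|r us IH] [|a u] [|b v] //= /andP[au cu] /andP[bv cv].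
rewrite IH // andbT.
have [su sv] := (closed_size cu, closed_size cv).
case: a au => /= [ru|_]; last case: b bv => //= rv.
  by rewrite ormC lem_ormr // (lem_size ru) su.
by rewrite lem_ormr // (lem_size rv) sv.
Qed.

Lemma mem_map_cons (b c : bool) (s : seq bitseq) m :
  (b :: m \in map (cons c) s) = (b == c) && (m \in s).
Proof.
apply/mapP/andP => [[p ps [-> ->]] | [/eqP-> ms]]; first by rewrite eqxx.
by exists m.
Qed.

(** By transitivity [orm u F] is closed, so the induction hypothesis covers the branch that takes
    the first point. *)
Lemma mem_masks us F m : transitive_rows us -> closed_mask us F ->
  (m \in masks us F) = closed_mask us m && lem F m.
Proof.
elim: us F m => [|u us IH] [|b F] [|c m] //=; rewrite ?inE //.
- move=> _ _; case: b; first by apply/mapP=> -[].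
  by rewrite mem_cat; apply/orP => -[] /mapP[].
case/andP=> cu tus /andP[bu cF].
have su : size u = size F by rewrite (closed_size cu) (closed_size cF).
case: b bu => /= bu; first rewrite mem_map_cons IH //.
  case: c => /=; last by rewrite andbF.
  case: (boolP (lem F m)) => [Fm|]; last by rewrite !andbF.
  by rewrite (lem_trans bu Fm).
rewrite mem_cat !mem_map_cons !IH ?closed_orm // lem_orm //.
by case: c => //=; [rewrite andbCA andbA | rewrite orbF].
Qed.

Lemma masks_uniq us F : uniq (masks us F).
Proof.
have inj (b : bool) : injective (cons b) by move=> ? ? [].
elim: us F => [|u us IH] [|b F] //=.
case: b; first by rewrite map_inj_uniq.
rewrite cat_uniq !map_inj_uniq // !IH /= andbT.
by apply/hasPn=> _ /mapP[m _ ->]; rewrite mem_map_cons.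
Qed.

Lemma eq_tabulate us F h h' : h =1 h' -> tabulate us F h = tabulate us F h'.
Proof.
elim: us F h h' => [|u us IH] [|b F] h h' e /=; rewrite ?e //.
have ec c : h \o cons c =1 h' \o cons c by move=> m; exact: e.
by case: b; rewrite !(IH _ _ _ (ec _)).
Qed.

(** Since [F] lies below [F'], every mask above [F'] has a leaf in both trees, and leaves at the
    same mask are added. *)
Lemma add_tabulate us F F' h h' : transitive_rows us ->
    closed_mask us F -> closed_mask us F' -> lem F F' ->
  add_tree (tabulate us F' h') (tabulate us F h)
    = tabulate us F' (fun m => h' m + h m).
Proof.
elim: us F F' h h' => [|u us IH] [|b F] [|b' F'] h h' //=.
  by rewrite bin_of_natD.
case/andP=> cu tus /andP[bu cF] /andP[bu' cF'] /andP[bb' FF'].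
have su : size u = size F by rewrite (closed_size cu) (closed_size cF).
case: b' bb' bu' => /= bb' bu'.
  (* If the point is free for [F] only, the branch over [orm u F] is used; this mask lies below [F']
     because [F'] is closed and contains the point. *)
  case: b bb' bu => /= _ bu; rewrite IH //; first exact: closed_orm.
  by rewrite lem_orm // bu'.
case: b bb' bu => //= _ _; rewrite !IH //; try exact: closed_orm.
rewrite lem_orm // [orm u F']ormC lem_ormr ?lem_refl ?su ?(lem_size FF') //=.
by rewrite ormC lem_ormr.
Qed.

Lemma interval_treeE us F : transitive_rows us -> closed_mask us F ->
  interval_tree us F
    = tabulate us F (fun m => count (lem^~ m) (masks us F)).
Proof.
elim: us F => [|u us IH] [|b F] //= /andP[cu tus] /andP[bu cF].
have su : size u = size F by rewrite (closed_size cu) (closed_size cF).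
case: b bu => /= bu.
  rewrite IH //; congr Up; apply: eq_tabulate => m /=.
  by rewrite count_map; apply: eq_count => p.
have cuF := closed_orm cu cF.
rewrite !IH // add_tabulate //; last by rewrite lem_ormr ?lem_refl.
congr Fork; apply: eq_tabulate => m /=; rewrite count_cat !count_map.
  (* No mask containing the first point lies below one that lacks it. *)
  rewrite -[LHS]addn0 -(count_pred0 (masks us (orm u F))).
  by congr (_ + _); apply: eq_count.
by rewrite addnC; congr (_ + _); apply: eq_count.
Qed.

Lemma sum_tabulate (g : N -> N) us F h :
  sum_tree g (tabulate us F h)
    = \sum_(m <- masks us F) g (bin_of_nat (h m)) :> nat.
Proof.
elim: us F h => [|u us IH] [|b F] h /=; rewrite ?big_seq1 //.
case: b; first by rewrite /= IH big_map.
by rewrite nat_of_addN !IH big_cat !big_map.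
Qed.

Lemma sum_interval_tree (g : N -> N) us F : transitive_rows us -> closed_mask us F ->
  sum_tree g (interval_tree us F)
    = \sum_(m <- masks us F) g (bin_of_nat (count (lem^~ m) (masks us F))) :> nat.
Proof. by move=> tus cF; rewrite interval_treeE // sum_tabulate. Qed.

(** * Splitting monotone functions on a fixed variable *)

Definition lef n (f g : boolfun n) : bool := [forall x, f x ==> g x].

Lemma lefP n (f g : boolfun n) : reflect (forall x, f x -> g x) (lef f g).
Proof. by apply: (iffP forallP) => fg x; apply/implyP/fg. Qed.

Section Lift.
Variables (n : nat) (phi : 'I_n -> 'I_n).

Definition lift_fun (i : 'I_n.+1) : 'I_n.+1 :=
  if unlift ord0 i is Some j then lift ord0 (phi j) else ord0.

Definition behead_ffun (x : {ffun 'I_n.+1 -> bool}) : {ffun 'I_n -> bool} :=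
  [ffun j => x (lift ord0 j)].

Definition cons_ffun (b : bool) (x : {ffun 'I_n -> bool}) : {ffun 'I_n.+1 -> bool} :=
  [ffun i => if unlift ord0 i is Some j then x j else b].

Definition glue (p : boolfun n * boolfun n) : boolfun n.+1 :=
  [ffun x : {ffun 'I_n.+1 -> bool} =>
    if x ord0 then p.2 (behead_ffun x) else p.1 (behead_ffun x)].

Definition restrict0 (b : bool) (f : boolfun n.+1) : boolfun n :=
  [ffun x => f (cons_ffun b x)].

Definition unglue (f : boolfun n.+1) : boolfun n * boolfun n :=
  (restrict0 false f, restrict0 true f).

Lemma cons_ffun0 b x : cons_ffun b x ord0 = b.
Proof. by rewrite ffunE unlift_none. Qed.

Lemma cons_ffunS b x j : cons_ffun b x (lift ord0 j) = x j.
Proof. by rewrite ffunE liftK. Qed.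

Lemma cons_ffunK b : cancel (cons_ffun b) behead_ffun.
Proof. by move=> x; apply/ffunP=> j; rewrite ffunE cons_ffunS. Qed.

Lemma behead_ffunK (x : {ffun 'I_n.+1 -> bool}) : cons_ffun (x ord0) (behead_ffun x) = x.
Proof. by apply/ffunP=> i; rewrite ffunE; case: unliftP => [j|] ->; rewrite ?ffunE. Qed.

Lemma glue_cons p b x : glue p (cons_ffun b x) = if b then p.2 x else p.1 x.
Proof. by rewrite ffunE cons_ffun0 cons_ffunK. Qed.

Lemma glueK : cancel glue unglue.
Proof.
by case=> f0 f1; congr (_, _); apply/ffunP=> x; rewrite ffunE glue_cons.
Qed.

Lemma unglueK : cancel unglue glue.
Proof.
by move=> f; apply/ffunP=> x; rewrite ffunE -[in RHS](behead_ffunK x); case: (x ord0); rewrite ffunE.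
Qed.

Lemma rename_cons b x : rename lift_fun (cons_ffun b x) = cons_ffun b (rename phi x).
Proof.
apply/ffunP=> i; rewrite ffunE /lift_fun; case: (unliftP ord0 i) => [j|] ->.
  by rewrite !cons_ffunS ffunE.
by rewrite !cons_ffun0.
Qed.

(** Monotonicity in the new variable is the comparison of the two restrictions; as [lift_fun] fixes
    that variable, invariance can be tested on each restriction. *)
Lemma glue_fixed p :
  (glue p \in fixed lift_fun) = [&& p.1 \in fixed phi, p.2 \in fixed phi & lef p.1 p.2].
Proof.
apply/fixedP/and3P => [[/monotoneP mf ff]|].
  have partE b x : restrict0 b (glue p) x = glue p (cons_ffun b x) by rewrite ffunE.
  have part b : restrict0 b (glue p) \in fixed phi.
    apply/fixedP; split=> [|x]; last by rewrite !partE -rename_cons ff.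
    apply/monotoneP=> x y xy; rewrite !partE; apply: mf => i.
    by rewrite !ffunE; case: unlift => // j; apply: xy.
  split.
  - by rewrite -[p]glueK; exact: (part false).
  - by rewrite -[p]glueK; exact: (part true).
  apply/lefP=> x; have := mf (cons_ffun false x) (cons_ffun true x).
  by rewrite !glue_cons; apply=> i; rewrite !ffunE; case: unlift.
case=> /fixedP[/monotoneP m0 f0] /fixedP[/monotoneP m1 f1] /lefP f01; split.
  apply/monotoneP=> x y xy; rewrite !ffunE.
  have bxy i : behead_ffun x i -> behead_ffun y i by rewrite !ffunE; apply: xy.
  have := xy ord0; case: (x ord0); case: (y ord0) => /= xy0.
  - exact: m1.
  - by have := xy0 isT.
  - by move/f01; apply: m1.
  - exact: m0.
move=> x; rewrite -[x]behead_ffunK rename_cons !glue_cons.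
by rewrite f0 f1.
Qed.

Lemma big_fixed_lift (H : boolfun n.+1 -> nat) :
  \sum_(f in fixed lift_fun) H f =
  \sum_(f0 in fixed phi) \sum_(f1 in fixed phi | lef f0 f1) H (glue (f0, f1)).
Proof.
rewrite (reindex glue); last by apply: onW_bij; exists unglue; [exact: glueK | exact: unglueK].
rewrite pair_big_dep /=; apply: eq_big => [[f0 f1]|[f0 f1] _] //=.
exact: glue_fixed.
Qed.

Lemma lef_glue p q : lef (glue p) (glue q) = lef p.1 q.1 && lef p.2 q.2.
Proof.
apply/lefP/andP => [pq|[/lefP pq1 /lefP pq2] x]; last first.
  by rewrite !ffunE; case: ifP => _; [apply: pq2 | apply: pq1].
by split; apply/lefP=> x; [have := pq (cons_ffun false x) | have := pq (cons_ffun true x)];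
  rewrite !glue_cons.
Qed.

End Lift.

(** Pairs are counted by their upper member, to match the leaves of [interval_tree] at the empty
    mask. *)
Lemma card_fixed_lift n (phi : 'I_n -> 'I_n) :
  #|fixed (lift_fun phi)| =
  \sum_(f in fixed phi) #|[set g in fixed phi | lef g f]|.
Proof.
rewrite -sum1_card big_fixed_lift (exchange_big_dep (mem (fixed phi))) /=.
  by apply: eq_bigr => f Lf; rewrite -sum1_card; apply: eq_bigl => g; rewrite inE Lf.
by move=> f g _ /andP[].
Qed.

(* Restricting two fixed variables gives four functions f <= h, h' <= g; given
   f and g, the two middle ones are independent. *)
Lemma card_fixed_lift2 n (phi : 'I_n -> 'I_n) :
  #|fixed (lift_fun (lift_fun phi))| =
  \sum_(f in fixed phi) \sum_(g in fixed phi | lef f g)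
     #|[set h in fixed phi | lef f h && lef h g]| ^ 2.
Proof.
rewrite -sum1_card big_fixed_lift big_fixed_lift /=; apply: eq_bigr => f Lf.
pose A h g : nat := lef f h && lef h g.
(* The restrictions along the outer variable are [glue (f, h)] and [glue (h', g)]; the product of
   the two values of [A] encodes all four comparisons. *)
transitivity (\sum_(h in fixed phi) \sum_(h' in fixed phi) \sum_(g in fixed phi)
                 A h g * A h' g).
  rewrite big_mkcondr; apply: eq_bigr => h Lh; rewrite /A.
  case: (lef f h); last by rewrite big1 // => h' _; rewrite big1.
  rewrite big_mkcondr big_fixed_lift; apply: eq_bigr => h' Lh'.
  rewrite big_mkcondr; apply: eq_bigr => g Lg; rewrite lef_glue /=.
  by case: (lef f h'); case: (lef h g); case: (lef h' g).
under eq_bigr do rewrite exchange_big; rewrite exchange_big [RHS]big_mkcondr /=.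
apply: eq_bigr => g Lg.
have -> : #|[set h in fixed phi | lef f h && lef h g]| = \sum_(h in fixed phi) A h g.
  move: (fixed phi) => L; rewrite -sum1_card [RHS]big_mkcond [LHS]big_mkcond; apply: eq_bigr => h _.
  by rewrite inE /A; case: (h \in L) => //=; case: (_ && _).
case: ifPn => [_|nfg].
  by rewrite -mulnn big_distrl; apply: eq_bigr => h _; rewrite big_distrr.
rewrite big1 // => h _; rewrite big1 // => h' _; rewrite /A.
case: andP => [[fh hg]|//]; case/lefP: nfg => x fx.
by have/lefP := hg; apply; have /lefP := fh; apply.
Qed.

(** * The poset of orbits on the cube, and fixed functions as masks *)

Fixpoint points (n : nat) : seq bitseq :=
  if n is n'.+1 then map (cons false) (points n') ++ map (cons true) (points n')
  else [:: [::]].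

Definition permute (t : seq nat) (v : bitseq) : bitseq := [seq nth false v j | j <- t].

(** The order on orbits: [v] lies below some point of the orbit of [w]. [K] is a period of the
    permutation, so that [K] iterates exhaust the orbit. *)
Definition orbit_le (t : seq nat) (K : nat) (v w : bitseq) : bool :=
  has (lem v) (traject (permute t) w K).

Fixpoint rows (le : rel bitseq) (s : seq bitseq) : seq bitseq :=
  if s is v :: s' then [seq le v w | w <- s'] :: rows le s' else [::].

(** The default [i] makes the map total: an entry out of range fixes [i]. *)
Definition seq_fun n (t : seq nat) (i : 'I_n) : 'I_n := insubd i (nth 0 t i).

Definition ffun_of n (v : bitseq) : {ffun 'I_n -> bool} := [ffun i : 'I_n => nth false v i].

Definition seq_of n (x : {ffun 'I_n -> bool}) : bitseq := [seq x i | i <- enum 'I_n].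

Definition values n (s : seq bitseq) (f : boolfun n) : bitseq := [seq f (ffun_of n v) | v <- s].

(* The last condition says that the list of representatives is a linear
   extension of the orbit poset, without repetition. *)
Definition orbit_reps n t K (s : seq bitseq) : bool :=
  [&& size t == n, all (fun j => j < n) t, all (fun v => size v == n) s, 0 < K,
      all (fun v => iter K (permute t) v == v) (points n),
      all (fun v => has (fun w => v \in traject (permute t) w K) s) (points n) &
      pairwise (fun v w => ~~ orbit_le t K w v) s].

Lemma mem_points n v : (v \in points n) = (size v == n).
Proof.
elim: n v => [|n IH] [|b v] //=; rewrite mem_cat.
  by apply/norP; split; apply/mapP=> -[].
by rewrite !mem_map_cons !IH eqSS; case: b; rewrite ?orbF.
Qed.

Lemma lem_nthP u v : reflect (size u = size v /\ forall i, nth false u i -> nth false v i) (lem u v).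
Proof.
elim: u v => [|a u IH] [|b v] /=; try by constructor; try case; move=> *; rewrite ?nth_nil.
apply: (iffP andP) => [[ab /IH[-> uv]]|[[suv] uv]].
  by split=> // -[|i] //=; [apply/implyP | apply: uv].
by split; [apply/implyP/(uv 0) | apply/IH; split=> // i; apply: (uv i.+1)].
Qed.

Lemma size_seq_of n (x : {ffun 'I_n -> bool}) : size (seq_of x) = n.
Proof. by rewrite size_map size_enum_ord. Qed.

Lemma nth_seq_of n (x : {ffun 'I_n -> bool}) (i : 'I_n) : nth false (seq_of x) i = x i.
Proof. by rewrite (nth_map i) ?size_enum_ord // nth_ord_enum. Qed.

Lemma seq_ofK n : cancel (@seq_of n) (ffun_of n).
Proof. by move=> x; apply/ffunP=> i; rewrite ffunE nth_seq_of. Qed.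

Lemma ffun_ofK n v : size v = n -> seq_of (ffun_of n v) = v.
Proof.
move=> sv; apply: (@eq_from_nth _ false); rewrite size_seq_of // => i ilt.
by rewrite -[i]/(val (Ordinal ilt)) nth_seq_of ffunE.
Qed.

Lemma closed_rows le (F : bitseq -> bool) s :
  closed_mask (rows le s) (map F s) = pairwise (fun v w => F v ==> le v w ==> F w) s.
Proof.
elim: s => //= v s ->; congr (_ && _).
have -> : lem [seq le v w | w <- s] (map F s) = all (fun w => le v w ==> F w) s.
  by elim: s => //= w s ->.
by case: (F v) => //=; rewrite all_predT.
Qed.

Lemma size_rows le s : size (rows le s) = size s.
Proof. by elim: s => //= v s ->. Qed.

Section OrbitReps.
Variables (n : nat) (t : seq nat) (K : nat) (s : seq bitseq).
Hypothesis s_ok : orbit_reps n t K s.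

Let size_t : size t = n. Proof. by case/and5P: s_ok => /eqP. Qed.
Let t_lt i : i < n -> nth 0 t i < n.
Proof. by case/and5P: s_ok => _ /all_nthP h _ _ _ ilt; apply: h; rewrite size_t. Qed.
Let size_s v : v \in s -> size v = n.
Proof. by case/and5P: s_ok => _ _ /allP h _ _ /h/eqP. Qed.
Let K_gt0 : 0 < K. Proof. by case/and5P: s_ok. Qed.
Let iterK v : size v = n -> iter K (permute t) v = v.
Proof.
by case/and5P: s_ok => _ _ _ _ /and3P[/allP h _ _] sv; apply/eqP/h; rewrite mem_points sv.
Qed.
Let cover v : size v = n -> exists2 w, w \in s & exists k, v = iter k (permute t) w.
Proof.
case/and5P: s_ok => _ _ _ _ /and3P[_ /allP h _] sv.
have /h/hasP[w ws /trajectP[k _ e]] : v \in points n by rewrite mem_points sv.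
by exists w => //; exists k.
Qed.
Let forward : pairwise (fun v w => ~~ orbit_le t K w v) s.
Proof. by case/and5P: s_ok => _ _ _ _ /and3P[]. Qed.

Lemma size_permute v : size (permute t v) = n.
Proof. by rewrite size_map. Qed.

Lemma size_iter_permute k v : size v = n -> size (iter k (permute t) v) = n.
Proof. by case: k => //= k _; rewrite size_permute. Qed.

Lemma rename_seq_fun v : rename (seq_fun t) (ffun_of n v) = ffun_of n (permute t v).
Proof.
apply/ffunP=> i; rewrite !ffunE (nth_map 0) ?size_t // /seq_fun.
by rewrite val_insubd t_lt.
Qed.

Lemma fixed_iter f k v : f \in fixed (@seq_fun n t) ->
  f (ffun_of n (iter k (permute t) v)) = f (ffun_of n v).
Proof.
case/fixedP=> _ ff; elim: k => //= k <-.
by rewrite -rename_seq_fun ff.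
Qed.

(** Exponents reduce modulo the period [K]. *)
Lemma orbit_leP v w : size w = n ->
  reflect (exists k, lem v (iter k (permute t) w)) (orbit_le t K v w).
Proof.
move=> sw; apply: (iffP hasP) => [[u /trajectP[k _ ->] vu]|[k vk]]; first by exists k.
exists (iter (k %% K) (permute t) w); first by apply/trajectP; exists (k %% K); rewrite ?ltn_mod.
have iterM q : iter (q * K) (permute t) w = w.
  by elim: q => // q IH; rewrite mulSn iterD IH iterK.
by move: vk; rewrite {1}(divn_eq k K) addnC iterD iterM.
Qed.

Lemma orbit_le_refl v : size v = n -> orbit_le t K v v.
Proof. by move=> sv; apply/orbit_leP=> //; exists 0; apply: lem_refl. Qed.

Lemma orbit_le_permute v w : size w = n -> orbit_le t K v (permute t w) = orbit_le t K v w.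
Proof.
move=> sw; apply/orbit_leP/orbit_leP; rewrite ?size_permute // => -[k vk].
  by exists k.+1; rewrite iterSr.
(* The [K.-1] extra steps complete the one already made to a full period. *)
exists (k + K.-1); rewrite iterD -iterSr prednK // iterK //.
Qed.

Lemma lem_permute u v : size u = n -> lem u v -> lem (permute t u) (permute t v).
Proof.
move=> su /lem_nthP[suv uv]; apply/lem_nthP; split=> [|i]; first by rewrite !size_map.
have [ilt|ige] := ltnP i (size t); last by rewrite nth_default // size_map.
by rewrite !(nth_map 0) //; apply: uv.
Qed.

Lemma orbit_le_lem v w w' : size w = n -> lem w w' -> orbit_le t K v w -> orbit_le t K v w'.
Proof.
move=> sw ww' /(orbit_leP _ sw)[k vk]; apply/orbit_leP; first by rewrite -(lem_size ww').
exists k; apply: lem_trans vk _; elim: k => //= k IH.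
by apply: lem_permute => //; apply: size_iter_permute.
Qed.

Lemma fixed_orbit_le f v w : f \in fixed (@seq_fun n t) -> size w = n ->
  orbit_le t K v w -> f (ffun_of n v) -> f (ffun_of n w).
Proof.
move=> Lf sw /(orbit_leP _ sw)[k /lem_nthP[_ vk]] fv.
rewrite -(fixed_iter k _ Lf); have /fixedP[/monotoneP mf _] := Lf.
by apply: mf fv => i; rewrite !ffunE; apply: vk.
Qed.

Lemma values_closed f : f \in fixed (@seq_fun n t) -> closed_mask (rows (orbit_le t K) s) (values s f).
Proof.
move=> Lf; rewrite closed_rows; apply/(pairwiseP [::]) => i j _ jlt _.
apply/implyP=> fi; apply/implyP=> ij.
by apply: fixed_orbit_le Lf _ ij fi; apply/size_s/mem_nth.
Qed.

(** Fixed functions are constant on orbits and every orbit meets [s], so comparing values on [s]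
    suffices. *)
Lemma lem_values f g : f \in fixed (@seq_fun n t) -> g \in fixed (@seq_fun n t) ->
  lem (values s f) (values s g) = lef f g.
Proof.
move=> Lf Lg.
have -> : lem (values s f) (values s g) = all (fun v => f (ffun_of n v) ==> g (ffun_of n v)) s.
  by rewrite /values; elim: (s) => //= v s' ->.
apply/allP/lefP => [fg x|fg v _]; last by apply/implyP/fg.
have [w ws [k e]] := cover (size_seq_of x).
rewrite -[x]seq_ofK e !fixed_iter //; exact/implyP/fg.
Qed.

Lemma values_inj : {in fixed (@seq_fun n t) &, injective (@values n s)}.
Proof.
move=> f g Lf Lg fg; apply/ffunP=> x; apply/idP/idP.
  by apply/lefP; rewrite -lem_values // fg lem_refl.
by apply/lefP; rewrite -lem_values // fg lem_refl.
Qed.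

Lemma reps_uniq : uniq s.
Proof.
rewrite uniq_pairwise; apply/(pairwiseP [::]) => i j ilt jlt ij.
apply: contraNneq (pairwiseP [::] forward _ _ ilt jlt ij) => ->.
exact/orbit_le_refl/size_s/mem_nth.
Qed.

(** The function is true at the points above some marked representative. On [s] it returns the mask:
    a marked [r] below [v] cannot come after [v] in the linear extension, so closedness marks
    [v]. *)
Lemma values_surj m : closed_mask (rows (orbit_le t K) s) m ->
  exists2 f, f \in fixed (@seq_fun n t) & m = values s f.
Proof.
move=> cm; have sm : size m = size s by rewrite (closed_size cm) size_rows.
pose G r := nth false m (index r s).
have mG : m = map G s.
  apply: (@eq_from_nth _ false); rewrite ?size_map // => i; rewrite sm => ilt.
  by rewrite (nth_map [::]) // /G index_uniq // reps_uniq.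
move: cm; rewrite mG closed_rows => cG.
pose f : boolfun n := [ffun x => has (fun r => G r && orbit_le t K r (seq_of x)) s].
exists f.
  apply/fixedP; split.
    apply/monotoneP=> x y xy; rewrite !ffunE => /hasP[r rs /andP[Gr rx]].
    apply/hasP; exists r; rewrite // Gr; apply: orbit_le_lem rx; first exact: size_seq_of.
    apply/lem_nthP; rewrite !size_seq_of; split=> // i.
    have [ilt|ige] := ltnP i n; last by rewrite nth_default // size_seq_of.
    by rewrite -[i]/(val (Ordinal ilt)) !nth_seq_of; apply: xy.
  move=> x; rewrite !ffunE; apply: eq_has => r; rewrite -[x in LHS]seq_ofK.
  by rewrite rename_seq_fun ffun_ofK ?size_permute // orbit_le_permute ?size_seq_of.
apply/eq_in_map => v vs; rewrite ffunE ffun_ofK ?size_s //; apply/idP/hasP => [Gv|].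
  by exists v => //; rewrite Gv orbit_le_refl ?size_s.
case=> r rs /andP[Gr rv]; have [vi ri] := (nth_index [::] vs, nth_index [::] rs).
have [vlt rlt] : index v s < size s /\ index r s < size s by rewrite !index_mem.
have [ij|ji|ij] := ltngtP (index r s) (index v s).
- have := pairwiseP [::] cG _ _ rlt vlt ij.
  by rewrite vi ri Gr rv.
- have := pairwiseP [::] forward _ _ vlt rlt ji.
  by rewrite vi ri rv.
by rewrite -vi -ij ri.
Qed.

Hypothesis trans_s : transitive_rows (rows (orbit_le t K) s).

Let us := rows (orbit_le t K) s.
Let none := nseq (size s) false.

Lemma closed_none : closed_mask us none.
Proof.
have -> : none = map (fun=> false) s by rewrite /none; elim: (s) => //= v s' ->.
by rewrite closed_rows; apply/(pairwiseP [::]).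
Qed.

(** [values] is a bijection from the fixed functions to the closed masks; sums over [fixed] thus
    become sums over a computable list. *)
Lemma perm_masks : perm_eq [seq values s f | f in fixed (@seq_fun n t)] (masks us none).
Proof.
apply: uniq_perm; first 1 last; [exact: masks_uniq| |].
  move=> m; rewrite mem_masks ?closed_none //.
  apply/imageP/andP => [[f Lf ->]|[cm _]]; last exact: values_surj.
  split; first exact: values_closed.
  by rewrite /none /values; elim: (s) => //= v s' ->.
rewrite map_inj_in_uniq ?enum_uniq // => f g; rewrite !mem_enum; exact: values_inj.
Qed.

Lemma big_fixed_values (h : bitseq -> nat) :
  \sum_(f in fixed (@seq_fun n t)) h (values s f) = \sum_(m <- masks us none) h m.
Proof. by rewrite -(perm_big _ perm_masks) big_map big_enum. Qed.

Lemma big_masks (h : bitseq -> nat) m : closed_mask us m ->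
  \sum_(m' <- masks us m) h m' = \sum_(m' <- masks us none | lem m m') h m'.
Proof.
move=> cm; rewrite -[RHS]big_filter; apply: perm_big; apply: uniq_perm.
- exact: masks_uniq.
- exact/filter_uniq/masks_uniq.
move=> m'; rewrite mem_filter !mem_masks ?closed_none // andbC.
case: (boolP (closed_mask us m')) => [cm'|]; rewrite ?andbF //=.
have -> : lem none m'; last by rewrite andbT.
have: size m' = size s by rewrite (closed_size cm') size_rows.
by rewrite /none => <-; elim: (m').
Qed.

Lemma card_fixed_masks : #|fixed (@seq_fun n t)| = size (masks us none).
Proof. by rewrite -sum1_card (big_fixed_values (fun=> 1)) sum1_size. Qed.

Lemma count_masks m m' : closed_mask us m ->
  count (lem^~ m') (masks us m) = \sum_(p <- masks us none | lem m p && lem p m') 1.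
Proof. by move=> cm; rewrite -sum1_count big_mkcond big_masks // -big_mkcondr. Qed.

Lemma card_fixed_lift_masks :
  #|fixed (lift_fun (@seq_fun n t))| = sum_tree id (interval_tree us none).
Proof.
rewrite card_fixed_lift sum_interval_tree ?closed_none //.
under [RHS]eq_bigr do rewrite bin_of_natK.
rewrite -big_fixed_values; apply: eq_bigr => f Lf.
rewrite -sum1_count big_mkcond -big_fixed_values -sum1_card big_mkcond [RHS]big_mkcond.
apply: eq_bigr => g _; rewrite in_set; case: (boolP (g \in fixed _)) => //= Lg.
by rewrite lem_values.
Qed.

Lemma sum_squares_values f : f \in fixed (@seq_fun n t) ->
  sum_tree (fun a => a * a)%num (interval_tree us (values s f)) =
  \sum_(g in fixed (@seq_fun n t) | lef f g)
     #|[set h in fixed (@seq_fun n t) | lef f h && lef h g]| ^ 2 :> nat.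
Proof.
move=> Lf; have cf := values_closed Lf.
rewrite sum_interval_tree // big_masks // big_mkcond -big_fixed_values.
rewrite [RHS]big_mkcondr; apply: eq_bigr => g Lg; rewrite lem_values //; case: ifP => // _.
rewrite nat_of_mulN bin_of_natK mulnn count_masks //; congr (_ ^ 2).
rewrite big_mkcond -big_fixed_values -sum1_card big_mkcond [RHS]big_mkcond.
apply: eq_bigr => h _; rewrite in_set; case: (boolP (h \in fixed _)) => //= Lh.
by rewrite !lem_values.
Qed.

Lemma card_fixed_lift2_masks :
  #|fixed (lift_fun (lift_fun (@seq_fun n t)))| =
  \sum_(m <- masks us none) sum_tree (fun a => a * a)%num (interval_tree us m).
Proof.
rewrite card_fixed_lift2 -big_fixed_values; apply: eq_bigr => f Lf.
by rewrite sum_squares_values.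
Qed.
End OrbitReps.

(** * Permutations given by lists *)

(* The identity when [u] does not list a permutation of 0, ..., n - 1. *)
Definition seq_perm n (u : seq nat) : 'S_n :=
  if injectiveP (@seq_fun n u) is ReflectT inj then perm inj else 1%g.

Lemma seq_permE n u : perm_eq u (iota 0 n) -> @seq_perm n u =1 @seq_fun n u.
Proof.
move=> pu; have su : size u = n by rewrite (perm_size pu) size_iota.
have ult i : i < n -> nth 0 u i < n.
  move=> ilt; have := mem_nth 0 (_ : i < size u); rewrite su => /(_ ilt).
  by rewrite (perm_mem pu) mem_iota.
have uu : uniq u by rewrite (perm_uniq pu) iota_uniq.
move=> i; rewrite /seq_perm; case: injectiveP => [inj|[]]; first by rewrite permE.
move=> {}i j /(congr1 val); rewrite !val_insubd !ult // => /eqP.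
by rewrite nth_uniq ?su // => /eqP/val_inj.
Qed.

Lemma eq_fixed n (phi psi : 'I_n -> 'I_n) : phi =1 psi -> fixed phi = fixed psi.
Proof.
move=> e; apply/setP=> f; rewrite !inE; congr (_ && _); apply: eq_forallb => x.
by congr (f _ == _); apply/ffunP=> i; rewrite !ffunE e.
Qed.

Lemma seq_fun_lift n t : size t = n -> all (fun j => j < n) t ->
  @seq_fun n.+1 (0 :: map S t) =1 lift_fun (@seq_fun n t).
Proof.
move=> st tlt i; apply/val_inj; rewrite /lift_fun /seq_fun.
have {}tlt (j : 'I_n) : nth 0 t j < n by apply: (all_nthP 0 tlt); rewrite st.
case: unliftP => [j|] ->; rewrite val_insubd //.
have -> : nth 0 (0 :: map S t) (lift ord0 j) = (nth 0 t j).+1 by rewrite lift0 /= (nth_map 0) ?st.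
by rewrite ltnS tlt [RHS]lift0 val_insubd tlt.
Qed.

(** * Invariance under renaming, and reduction of masks to normal forms *)

Lemma lef_rename n (f g : boolfun n) (q : 'S_n) : lef (rename_fun f q) (rename_fun g q) = lef f g.
Proof.
apply/lefP/lefP => fg x; last by rewrite !ffunE; apply: fg.
have := fg (rename q^-1%g x); rewrite !ffunE.
suff -> : rename q (rename q^-1%g x) = x by [].
by apply/ffunP=> i; rewrite !ffunE permK.
Qed.

Lemma rename_fun_inj n (q : 'S_n) : injective (fun f => rename_fun f q).
Proof.
by move=> f g /(congr1 (fun f => rename_fun f q^-1%g)); rewrite -!rename_funM mulgV !rename_fun1.
Qed.

(** Renaming by [q] is an order automorphism of [L], so it carries the intervals above [f] to those
    above its image. *)
Lemma sum_squares_rename n (L : {set boolfun n}) (q : 'S_n) (f : boolfun n) :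
    (forall g, (rename_fun g q \in L) = (g \in L)) ->
  \sum_(g in L | lef (rename_fun f q) g)
     #|[set h in L | lef (rename_fun f q) h && lef h g]| ^ 2 =
  \sum_(g in L | lef f g) #|[set h in L | lef f h && lef h g]| ^ 2.
Proof.
move=> Lq; rewrite (reindex_inj (@rename_fun_inj n q)) /=.
apply: eq_big => [g|g _]; first by rewrite Lq lef_rename.
congr (_ ^ 2); rewrite -[RHS](card_imset _ (@rename_fun_inj n q)).
apply: eq_card => h; rewrite in_set; apply/idP/imsetP.
  pose h' := rename_fun h q^-1%g.
  have eh : h = rename_fun h' q by rewrite -rename_funM mulVg rename_fun1.
  by rewrite eh Lq !lef_rename => ?; exists h'; rewrite ?inE.
by case=> h'; rewrite in_set => hh ->; rewrite Lq !lef_rename.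
Qed.

(* Exchanging two adjacent variables acts on the lexicographic list of the points
   of the cube by exchanging the middle two of every four consecutive blocks. *)
Fixpoint swap_blocks T (c k : nat) (m : seq T) : seq T :=
  if c is c'.+1 then
    let m1 := drop k m in let m2 := drop k m1 in let m3 := drop k m2 in
    take k m ++ take k m2 ++ take k m1 ++ take k m3 ++ swap_blocks c' k (drop k m3)
  else [::].

Lemma map_swap_blocks T T' (F : T -> T') c k m :
  swap_blocks c k (map F m) = map F (swap_blocks c k m).
Proof. by elim: c m => //= c IH m; rewrite !map_cat !map_take !map_drop -!IH !map_drop. Qed.

(** Strict lexicographic order, with [false] before [true]. *)
Fixpoint ltm (u v : bitseq) : bool :=
  match u, v with
  | a :: u', b :: v' => if a then b && ltm u' v' else b || ltm u' v'
  | _, _ => false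
  end.

Fixpoint lower_swap (cks : seq (nat * nat)) (m : bitseq) : option bitseq :=
  if cks is (c, k) :: cks' then
    let m' := swap_blocks c k m in if ltm m' m then Some m' else lower_swap cks' m
  else None.

(* Sorting by adjacent exchanges as long as the mask decreases. The result need
   not be canonical: only the speed of the computation depends on that. *)
Fixpoint normalize (cks : seq (nat * nat)) (fuel : nat) (m : bitseq) : bitseq :=
  if fuel is fuel'.+1 then
    if lower_swap cks m is Some m' then normalize cks fuel' m' else m
  else m.

(** The result arises from [m] by exchanges taken from [cks], so it inherits whatever these
    preserve. *)
Lemma normalize_ind (P : bitseq -> Prop) cks fuel m :
    (forall c k m', (c, k) \in cks -> P m' -> P (swap_blocks c k m')) ->
  P m -> P (normalize cks fuel m).
Proof.
move=> Psw; elim: fuel m => //= fuel IH m Pm.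
case e: lower_swap => [m'|] //; apply: IH; move: e.
elim: cks Psw => //= -[c k] cks IHc Psw; case: ifP => _.
  by case=> <-; apply: Psw; rewrite ?mem_head.
by apply: IHc => // c' k' m'' ck; apply: Psw; rewrite inE ck orbT.
Qed.

(* Equal masks are grouped, so that [h] is evaluated once for each of them. *)
Fixpoint sum_by_prefix (k : nat) (h : bitseq -> N) (l : seq bitseq) : N :=
  if l is [::] then 0%num
  else if k is k'.+1 then
    (sum_by_prefix k' (fun m => h (false :: m)) [seq behead m | m <- l & ~~ head false m]
     + sum_by_prefix k' (fun m => h (true :: m)) [seq behead m | m <- l & head false m])%num
  else (bin_of_nat (size l) * h [::])%num.

Lemma sum_by_prefixE k h l : all (fun m => size m == k) l ->
  sum_by_prefix k h l = \sum_(m <- l) h m :> nat.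
Proof.
elim: k h l => [|k IH] h l lk.
  have -> : sum_by_prefix 0 h l = (bin_of_nat (size l) * h [::])%num by case: (l).
  rewrite nat_of_mulN bin_of_natK -sum1_size big_distrl /=.
  by apply: eq_big_seq => m /(allP lk); rewrite size_eq0 mul1n => /eqP->.
(* On an empty list the early exit agrees with the general formula, both parts being empty. *)
have -> : sum_by_prefix k.+1 h l =
   (sum_by_prefix k (fun m => h (false :: m)) [seq behead m | m <- l & ~~ head false m]
    + sum_by_prefix k (fun m => h (true :: m)) [seq behead m | m <- l & head false m])%num.
  by case: (l) => //=; case: (k).
have lkb (a : pred bitseq) : all (fun m => size m == k) [seq behead m | m <- l & a m].
  apply/allP=> _ /mapP[m + ->]; rewrite mem_filter => /andP[_ /(allP lk)].
  by rewrite size_behead => /eqP->.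
rewrite nat_of_addN !IH // [RHS](bigID (head false)) addnC /= !big_map !big_filter.
by congr (_ + _); rewrite big_seq_cond [RHS]big_seq_cond; apply: eq_bigr => -[|[] m] /andP[/(allP lk)].
Qed.

Definition square_sum (us : seq bitseq) (m : bitseq) : N :=
  sum_tree (fun a => a * a)%num (interval_tree us m).

Section Normalize.
Variables (n K : nat) (t : seq nat) (s : seq bitseq).
Hypothesis s_ok : orbit_reps n t K s.
Let us := rows (orbit_le t K) s.
Let none := nseq (size s) false.
Hypothesis trans_s : transitive_rows us.

(** The exchange of blocks in [s] is induced by the permutation [u] of the variables, and [u]
    commutes with [t]. *)
Definition swap_ok (ck : nat * nat) (u : seq nat) : bool :=
  [&& perm_eq u (iota 0 n), [seq permute u w | w <- s] == swap_blocks ck.1 ck.2 s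
    & [seq nth 0 t i | i <- u] == [seq nth 0 u i | i <- t]].

(** The exchanged mask is that of the function renamed by [u]; commuting with [t], this renaming
    preserves the lattice of fixed functions. *)
Lemma swap_masks c k u m : swap_ok (c, k) u -> m \in masks us none ->
  (swap_blocks c k m \in masks us none)
  /\ square_sum us (swap_blocks c k m) = square_sum us m :> nat.
Proof.
case/and3P=> pu /eqP us_swap /eqP ut.
rewrite -!(perm_mem (perm_masks s_ok trans_s)) => /imageP[f Lf ->].
pose q := @seq_perm n u; have qE := seq_permE pu.
have t_ok : size t = n /\ forall i, i < n -> nth 0 t i < n.
  by case/and5P: s_ok => /eqP st /(all_nthP 0) h _ _ _; split=> // i; have := h i; rewrite st.
have su : size u = n by rewrite (perm_size pu) size_iota.
have u_lt i : i < n -> nth 0 u i < n.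
  move=> ilt; have := mem_nth 0 (_ : i < size u); rewrite su => /(_ ilt).
  by rewrite (perm_mem pu) mem_iota.
have comm (x : {ffun 'I_n -> bool}) :
    rename q (rename (seq_fun t) x) = rename (seq_fun t) (rename q x).
  apply/ffunP=> i; rewrite !ffunE !qE; congr (x _); apply/val_inj.
  have [ti ui] := (t_ok.2 i (ltn_ord i), u_lt i (ltn_ord i)).
  rewrite !val_insubd ti ui (t_ok.2 _ ui) (u_lt _ ti).
  by move/(congr1 (nth 0 ^~ i)): ut; rewrite !(nth_map 0) ?su ?t_ok.1.
have Lq_imp g (r : 'S_n) : (forall x : {ffun 'I_n -> bool},
    rename r (rename (seq_fun t) x) = rename (seq_fun t) (rename r x)) ->
    g \in fixed (@seq_fun n t) -> rename_fun g r \in fixed (@seq_fun n t).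
  move=> rt /fixedP[mg gf]; apply/fixedP; rewrite monotone_rename; split=> // y.
  by rewrite !ffunE rt gf.
have renK (x : {ffun 'I_n -> bool}) : rename q (rename q^-1%g x) = x.
  by apply/ffunP=> i; rewrite !ffunE permK.
have renKV (x : {ffun 'I_n -> bool}) : rename q^-1%g (rename q x) = x.
  by apply/ffunP=> i; rewrite !ffunE permKV.
have Lq g : (rename_fun g q \in fixed (@seq_fun n t)) = (g \in fixed (@seq_fun n t)).
  apply/idP/idP; last exact: Lq_imp.
  move/(Lq_imp _ q^-1%g); rewrite -rename_funM mulgV rename_fun1; apply=> x.
  by rewrite -[x in LHS]renK -comm renKV.
have -> : swap_blocks c k (values s f) = values s (rename_fun f q).
  rewrite /values map_swap_blocks -us_swap -map_comp; apply/eq_in_map => v vs /=.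
  rewrite ffunE; congr (f _); apply/ffunP=> i.
  by rewrite !ffunE qE (nth_map 0) ?su // val_insubd u_lt.
split; first by apply/imageP; exists (rename_fun f q); rewrite ?Lq.
by rewrite /square_sum !(sum_squares_values s_ok) ?Lq // sum_squares_rename.
Qed.

(** Exchanges keep [square_sum], so each mask may be replaced by its normal form. *)
Lemma card_fixed_lift2_normalize cks us' fuel : all2 swap_ok cks us' ->
  #|fixed (lift_fun (lift_fun (@seq_fun n t)))| =
  sum_by_prefix (size s) (square_sum us) [seq normalize cks fuel m | m <- masks us none].
Proof.
move=> cks_ok; rewrite (card_fixed_lift2_masks s_ok trans_s).
have nm m : m \in masks us none -> (normalize cks fuel m \in masks us none)
    /\ square_sum us (normalize cks fuel m) = square_sum us m :> nat.
  move=> mM; apply: (normalize_ind (P := fun m' => m' \in masks us none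
    /\ square_sum us m' = square_sum us m :> nat)) => // c k m' ck [m'M <-].
  have [u cku] : exists u, swap_ok (c, k) u.
    elim: cks us' cks_ok ck => //= ck' cks IH [|u us'] //= /andP[oku /IH IHu].
    by rewrite inE => /predU1P[->|/IHu//]; exists u.
  exact: swap_masks cku m'M.
rewrite sum_by_prefixE; first by rewrite big_map; apply: eq_big_seq => m /nm[_ ->].
apply/allP=> _ /mapP[m /nm[+ _] ->]; rewrite mem_masks ?closed_none // => /andP[/closed_size-> _].
by rewrite size_rows.
Qed.
End Normalize.

(** * The sum over all permutations, by cycle type *)

Definition perm_seq n (w : seq nat) : bool := [&& size w == n, all (fun i => i < n) w & uniq w].

Lemma perm_seqP n w : perm_seq n w -> perm_eq w (iota 0 n).
Proof.
case/and3P=> /eqP sw wlt uw; apply: uniq_perm; rewrite ?iota_uniq //.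
have sub : {subset w <= iota 0 n} by move=> i /(allP wlt); rewrite mem_iota.
by have [] := uniq_min_size uw sub; rewrite ?size_iota ?sw.
Qed.

(** Makes the sum computable: a permutation is determined by the list of its values, so [seq_perm]
    is a bijection from the listed permutations. *)
Lemma sum_permutations n (F : 'S_n -> nat) :
  \sum_s F s = \sum_(p <- permutations (iota 0 n)) F (seq_perm n p).
Proof.
rewrite -big_enum -(big_map (seq_perm n) predT F) /=; apply: perm_big.
apply: uniq_perm; first exact: enum_uniq.
  rewrite map_inj_in_uniq ?permutations_uniq // => p p'; rewrite !mem_permutations => pp pp' e.
  have sz q : perm_eq q (iota 0 n) -> size q = n by move/perm_size->; rewrite size_iota.
  have lt (q : seq nat) i : perm_eq q (iota 0 n) -> i < n -> nth 0 q i < n.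
    move=> qp ilt; have := mem_nth 0 (_ : i < size q); rewrite (sz q qp) => /(_ ilt).
    by rewrite (perm_mem qp) mem_iota.
  apply: (@eq_from_nth _ 0) => [|i]; rewrite !sz // => ilt.
  have /(congr1 val) : seq_perm n p (Ordinal ilt) = seq_perm n p' (Ordinal ilt) by rewrite e.
  by rewrite !seq_permE // !val_insubd !lt.
move=> s; rewrite mem_enum; apply/esym/mapP.
pose p := [seq val (s i) | i <- enum 'I_n].
have pp : perm_eq p (iota 0 n).
  apply: perm_seqP; apply/and3P; split; first by rewrite size_map size_enum_ord.
    by apply/allP=> _ /mapP[i _ ->] /=.
  by rewrite map_inj_uniq ?enum_uniq // => i j /val_inj/perm_inj.
exists p; first by rewrite mem_permutations.
apply/permP=> i; rewrite seq_permE //; apply/val_inj; rewrite val_insubd.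
by rewrite (nth_map i) ?size_enum_ord // nth_ord_enum ltn_ord.
Qed.

Lemma card_fixed_conj_seq n (p w r : seq nat) : perm_eq p (iota 0 n) -> perm_seq n w -> perm_seq n r ->
    all (fun i => nth 0 p (nth 0 w i) == nth 0 w (nth 0 r i)) (iota 0 n) ->
  #|fixed (seq_perm n p)| = #|fixed (seq_perm n r)|.
Proof.
move=> pp /perm_seqP wp /perm_seqP rp /allP pw.
apply: (@card_fixed_conj _ _ _ (seq_perm n w)) => i.
have lt (q : seq nat) j : perm_eq q (iota 0 n) -> j < n -> nth 0 q j < n.
  move=> qp jlt; have := mem_nth 0 (_ : j < size q); rewrite (perm_size qp) size_iota => /(_ jlt).
  by rewrite (perm_mem qp) mem_iota.
rewrite !seq_permE // /seq_fun; apply/val_inj; rewrite !val_insubd.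
have [wi ri] := (lt w i wp (ltn_ord i), lt r i rp (ltn_ord i)).
rewrite wi ri (lt p _ pp wi) (lt w _ wp ri).
by apply/eqP/pw; rewrite mem_iota ltn_ord.
Qed.

(** The permutation cycling consecutive blocks of positive lengths [ls], starting at [a]: each point
    goes to its successor, the last of a block to its first. *)
Fixpoint cycle_perm_from (a : nat) (ls : seq nat) : seq nat :=
  if ls is l :: ls' then iota a.+1 l.-1 ++ a :: cycle_perm_from (a + l) ls' else [::].

Definition cycle_perm := cycle_perm_from 0.

Fixpoint cycle_tail (p : seq nat) (i fuel j : nat) : seq nat :=
  if fuel is fuel'.+1 then
    if j == i then [::] else j :: cycle_tail p i fuel' (nth 0 p j)
  else [::].

(** Cycles come by increasing length, as in the keys of [fixed_counts]. *)
Definition cycles n (p : seq nat) : seq (seq nat) :=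
  let cs := foldl (fun cs i => if has (fun c => i \in c) cs then cs
                               else (i :: cycle_tail p i n (nth 0 p i)) :: cs)
                  [::] (iota 0 n) in
  flatten [seq [seq c <- cs | size c == l] | l <- iota 1 n].

(* The conjugation of [p] to the standard permutation of its cycle type is checked
   for each [p], which makes a correctness proof of [cycles] unnecessary. *)
Definition class_value n (table : seq (seq nat * N)) (p : seq nat) : option N :=
  let cs := cycles n p in let w := flatten cs in let ls := map size cs in
  let r := cycle_perm ls in
  if perm_seq n w && all (fun i => nth 0 p (nth 0 w i) == nth 0 w (nth 0 r i)) (iota 0 n)
  then omap snd (ohead [seq e <- table | e.1 == ls]) else None.

Fixpoint class_sum n table (ps : seq (seq nat)) : option N :=
  if ps is p :: ps' then
    if class_value n table p is Some c then omap (N.add c) (class_sum n table ps') else None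
  else Some 0%num.

(** Each term equals the table entry of its cycle type, by the conjugation that [class_value] has
    checked; a failed check or a missing type would give [None]. *)
Lemma class_sumP n (table : seq (seq nat * N)) (tot : N) :
    all (fun e => perm_seq n (cycle_perm e.1)) table ->
    (forall e, e \in table -> #|fixed (seq_perm n (cycle_perm e.1))| = e.2) ->
    class_sum n table (permutations (iota 0 n)) = Some tot ->
  \sum_(s : 'S_n) #|fixed s| = tot.
Proof.
move=> /allP tp tc; rewrite sum_permutations.
have : all (fun p => perm_eq p (iota 0 n)) (permutations (iota 0 n)).
  by apply/allP=> p; rewrite mem_permutations.
elim: (permutations _) tot => [|p ps IH] tot /=; first by move=> _ [<-]; rewrite big_nil.
case/andP=> pp /IH{}IH; rewrite /class_value.
set cs := cycles n p; case: andP => [[wp pw]|//].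
case e: [seq _ <- _ | _] => [|[ls c] tl] //=.
have : (ls, c) \in [seq e <- table | e.1 == map size cs] by rewrite e mem_head.
rewrite mem_filter /= => /andP[/eqP els lct].
case: class_sum IH => //= a IH [<-]; rewrite big_cons nat_of_addN (IH a) //; congr (_ + _).
rewrite -(tc _ lct); apply: card_fixed_conj_seq pp wp _ _; first exact: (tp _ lct).
by rewrite /= els.
Qed.

(** * Certified counts for a single permutation *)

(** The lexicographically least points of the orbits: the product order refines to the lexicographic
    one, so a lower orbit has an earlier least point. *)
Definition lex_reps n t K : seq bitseq :=
  [seq v <- points n | all (fun w => ~~ ltm w v) (traject (permute t) v K)].

(** The side conditions and the count form one Boolean, so that a single evaluation certifies an
    entry. *)
Definition fixed_count_ok n t K (count : seq bitseq -> bitseq -> N) (c : N) : bool :=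
  let s := lex_reps n t K in
  let us := rows (orbit_le t K) s in
  [&& perm_seq n t, orbit_reps n t K s, transitive_rows us
    & N.eqb (count us (nseq (size s) false)) c].

Definition sumN (h : bitseq -> N) (l : seq bitseq) : N := foldr (fun m a => (h m + a)%num) 0%num l.

(** The numeral is the number of fixed variables split off before the enumeration. *)
Definition count0 us none := sumN (fun=> 1%num) (masks us none).
Definition count1 us none := sum_tree id (interval_tree us none).
Definition count2 us none := sumN (square_sum us) (masks us none).

Lemma sumNE h l : sumN h l = \sum_(m <- l) h m :> nat.
Proof. by elim: l => [|m l IH]; rewrite ?big_nil // big_cons nat_of_addN IH. Qed.

Lemma fixed_count_okP n t K count c : fixed_count_ok n t K count c ->
  [/\ perm_seq n t, orbit_reps n t K (lex_reps n t K),
      transitive_rows (rows (orbit_le t K) (lex_reps n t K))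
    & count (rows (orbit_le t K) (lex_reps n t K)) (nseq (size (lex_reps n t K)) false) = c].
Proof. by case/and4P=> ? ? ? /N.eqb_eq. Qed.

Lemma card_fixed0 n t K c : fixed_count_ok n t K count0 c ->
  #|fixed (seq_perm n t)| = c.
Proof.
case/fixed_count_okP=> /perm_seqP pt sok tr <-; rewrite (eq_fixed (seq_permE pt)).
by rewrite (card_fixed_masks sok tr) sumNE sum1_size.
Qed.

Lemma perm_seq_lift n t : perm_seq n t -> perm_seq n.+1 (0 :: map S t).
Proof.
case/and3P=> /eqP st tlt ut; apply/and3P; split; rewrite /= ?size_map ?st ?eqxx //.
  by rewrite all_map.
by rewrite (map_inj_uniq succn_inj) ut andbT; apply/mapP=> -[].
Qed.

Lemma fixed_seq_perm_lift n t : perm_seq n t ->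
  fixed (seq_perm n.+1 (0 :: map S t)) = fixed (lift_fun (seq_perm n t)).
Proof.
move=> pt; have /perm_seqP/seq_permE e := perm_seq_lift pt; rewrite (eq_fixed e).
have [/eqP st tlt _] := and3P pt; apply: eq_fixed => i; rewrite (seq_fun_lift st tlt).
by rewrite /lift_fun; case: unlift => // j; rewrite seq_permE ?perm_seqP.
Qed.

Lemma eq_lift_fun n (phi psi : 'I_n -> 'I_n) : phi =1 psi -> lift_fun phi =1 lift_fun psi.
Proof. by move=> e i; rewrite /lift_fun; case: unlift => // j; rewrite e. Qed.

Lemma card_fixed1 n t K c : fixed_count_ok n t K count1 c ->
  #|fixed (seq_perm n.+1 (0 :: map S t))| = c.
Proof.
case/fixed_count_okP=> pt sok tr <-; rewrite fixed_seq_perm_lift //.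
by rewrite (eq_fixed (eq_lift_fun (seq_permE (perm_seqP pt)))) (card_fixed_lift_masks sok tr).
Qed.

Lemma fixed_seq_perm_lift2 n t : perm_seq n t ->
  fixed (seq_perm n.+2 (0 :: map S (0 :: map S t))) = fixed (lift_fun (lift_fun (@seq_fun n t))).
Proof.
move=> pt; rewrite fixed_seq_perm_lift ?perm_seq_lift //; apply/eq_fixed/eq_lift_fun => i.
have [/eqP st tlt _] := and3P pt.
by rewrite seq_permE ?perm_seqP ?perm_seq_lift // (seq_fun_lift st tlt).
Qed.

Lemma card_fixed2 n t K c : fixed_count_ok n t K count2 c ->
  #|fixed (seq_perm n.+2 (0 :: map S (0 :: map S t)))| = c.
Proof.
case/fixed_count_okP=> pt sok tr <-; rewrite fixed_seq_perm_lift2 //.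
by rewrite (card_fixed_lift2_masks sok tr) sumNE.
Qed.

Definition count2_normal cks fuel us none :=
  sum_by_prefix (size us) (square_sum us) [seq normalize cks fuel m | m <- masks us none].

Lemma card_fixed2_normal n t K cks us' fuel c :
    all2 (swap_ok n t (lex_reps n t K)) cks us' ->
    fixed_count_ok n t K (count2_normal cks fuel) c ->
  #|fixed (seq_perm n.+2 (0 :: map S (0 :: map S t)))| = c.
Proof.
move=> cks_ok /fixed_count_okP[pt sok tr <-]; rewrite fixed_seq_perm_lift2 //.
by rewrite (card_fixed_lift2_normalize sok tr fuel cks_ok) /count2_normal size_rows.
Qed.

(** * The counts for seven variables *)

Lemma cycle_perm_from_add a b ls :
  cycle_perm_from (a + b) ls = map (addn a) (cycle_perm_from b ls).
Proof.
elim: ls b => //= l ls IH b; rewrite map_cat /= -addnS iotaDl.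
by rewrite -addnA IH.
Qed.

(** Brings cycle types with a part 1 into the form required by [card_fixed1] and [card_fixed2]. *)
Lemma cycle_perm1 ls : cycle_perm (1 :: ls) = 0 :: map S (cycle_perm ls).
Proof. by rewrite /cycle_perm /= add0n -[1]/(1 + 0) cycle_perm_from_add. Qed.

(** The count is the Dedekind number of 7 variables. The pair [(c, k)] cuts the 32 points into
    [4 * c] blocks of size [k]; the four pairs exchange neighbouring variables. Any fuel is
    sound. *)
Lemma fixed_1111111 : fixed_count_ok 5 (cycle_perm [:: 1; 1; 1; 1; 1]) 1
  (count2_normal [:: (1, 8); (2, 4); (4, 2); (8, 1)] 20) 2414682040998.
Proof. vm_cast_no_check (erefl true). Qed.

Lemma fixed_111112 : fixed_count_ok 5 (cycle_perm [:: 1; 1; 1; 2]) 2 count2 2208001624.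
Proof. vm_cast_no_check (erefl true). Qed.

Definition fixed_counts : seq (seq nat * N) :=
  [:: ([:: 1; 1; 1; 1; 1; 1; 1], 2414682040998%num);
      ([:: 1; 1; 1; 1; 1; 2], 2208001624%num);
      ([:: 1; 1; 1; 2; 2], 67922470%num);
      ([:: 1; 2; 2; 2], 12015832%num);
      ([:: 1; 1; 1; 1; 3], 2068224%num);
      ([:: 1; 1; 2; 3], 59542%num);
      ([:: 2; 2; 3], 10192%num);
      ([:: 1; 3; 3], 69264%num);
      ([:: 1; 1; 1; 4], 60312%num);
      ([:: 1; 2; 4], 26878%num);
      ([:: 3; 4], 294%num);
      ([:: 1; 1; 5], 1548%num);
      ([:: 2; 5], 264%num);
      ([:: 1; 6], 766%num);
      ([:: 7], 101%num)].

Lemma card_fixed_counts e : e \in fixed_counts ->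
  #|fixed (seq_perm 7 (cycle_perm e.1))| = e.2.
Proof.
(* The lists are the transpositions of neighbouring variables that induce the four block
   exchanges. *)
have swaps_ok : all2
    (swap_ok 5 (cycle_perm [:: 1; 1; 1; 1; 1]) (lex_reps 5 (cycle_perm [:: 1; 1; 1; 1; 1]) 1))
    [:: (1, 8); (2, 4); (4, 2); (8, 1)]
    [:: [:: 1; 0; 2; 3; 4]; [:: 0; 2; 1; 3; 4]; [:: 0; 1; 3; 2; 4]; [:: 0; 1; 2; 4; 3]].
  by vm_cast_no_check (erefl true).
rewrite /fixed_counts !inE; do 14?[case/predU1P=> [->|]]; last move/eqP->.
all: rewrite [_.1]/= [_.2]/= ?cycle_perm1.
- exact: card_fixed2_normal swaps_ok fixed_1111111.
- exact: card_fixed2 fixed_111112.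
(* Here and below [K] is the least common multiple of the cycle lengths left after splitting off the
   fixed variables. *)
- apply: (card_fixed2 (K := 2)); vm_cast_no_check (erefl true).
- apply: (card_fixed1 (K := 2)); vm_cast_no_check (erefl true).
- apply: (card_fixed2 (K := 3)); vm_cast_no_check (erefl true).
- apply: (card_fixed2 (K := 6)); vm_cast_no_check (erefl true).
- apply: (card_fixed0 (K := 6)); vm_cast_no_check (erefl true).
- apply: (card_fixed1 (K := 3)); vm_cast_no_check (erefl true).
- apply: (card_fixed2 (K := 4)); vm_cast_no_check (erefl true).
- apply: (card_fixed1 (K := 4)); vm_cast_no_check (erefl true).
- apply: (card_fixed0 (K := 12)); vm_cast_no_check (erefl true).
- apply: (card_fixed2 (K := 5)); vm_cast_no_check (erefl true).
- apply: (card_fixed0 (K := 10)); vm_cast_no_check (erefl true).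
- apply: (card_fixed1 (K := 6)); vm_cast_no_check (erefl true).
- apply: (card_fixed0 (K := 7)); vm_cast_no_check (erefl true).
Qed.

(** All permutations are classified one by one; the total is written with the factor 5040, which is
    7!, for the final cancellation. *)
Lemma class_sum7 :
  class_sum 7 fixed_counts (permutations (iota 0 7)) = Some (490013148 * 5040)%num.
Proof. vm_cast_no_check (erefl (Some (490013148 * 5040)%num)). Qed.

(** Cancellation with the large factors kept in binary, as their unary forms could not be
    computed. *)
Lemma eq_of_mulN (x m : nat) (a b : N) :
  m = b -> 0 < m -> x * m = (a * b)%num -> x = a.
Proof. by move=> -> b_gt0 /eqP; rewrite nat_of_mulN eqn_pmul2r // => /eqP. Qed.

Theorem mainTheorem1 : R 7 = nat_of_bin 490013148%num.
Proof.
have types_ok : all (fun e => perm_seq 7 (cycle_perm e.1)) fixed_counts by [].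
have fact7 : 7`! = nat_of_bin 5040 by [].
apply: (eq_of_mulN fact7 (fact_gt0 7)); rewrite burnside.
exact: class_sumP types_ok card_fixed_counts class_sum7.
Qed.
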